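(* Let $(S,[\ ])$ and $(T,[\ ])$ be laterally commutative semiheaps with bi-unitary elements $l\in S$ and $k\in T$ respectively. Let $(S,* )$ be the groupoid with product $a*b=[lab]$ ($a,b\in S$) and let $(T,\circ)$ be the groupoid with product $a\circ b=[kab]$ ($a,b\in T$). Then $(S,[\ ])$ and $(T,[\ ])$ are isomorphic as ternary operations if and only if $(S,* )$ and $(T,\circ)$ are isomorphic as groupoids.
   Context: A set $S$ with a ternary operation $[\ ]$ is a semiheap if $[[xyz]uv]=[x[uzy]v]=[xy[zuv]]$ for all $x,y,z,u,v\in S$. It is laterally commutative if $[xyz]=[zyx]$ for all $x,y,z$. An element $l$ is bi-unitary if $[llx]=x=[xll]$ for all $x$. Two ternary operations on $S$ and $T$ are isomorphic if there is a bijection $\delta:S\to T$ with $\delta[abc]=[(\delta a)(\delta b)(\delta c)]$ for all $a,b,c\in S$. A groupoid is a set with a binary operation. *)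

(* Defs.v *)
From mathcomp Require Import all_boot.

Set Implicit Arguments.
Unset Strict Implicit.
Unset Printing Implicit Defensive.

Definition ternary_op (S : Type) : Type := S -> S -> S -> S.

Definition semiheap (S : Type) (t : ternary_op S) : Prop :=
  forall x y z u v : S,
    t (t x y z) u v = t x (t u z y) v /\ t x (t u z y) v = t x y (t z u v).

Definition laterally_commutative (S : Type) (t : ternary_op S) : Prop :=
  forall x y z : S, t x y z = t z y x.

Definition bi_unitary (S : Type) (t : ternary_op S) (l : S) : Prop :=
  forall x : S, t l l x = x /\ x = t x l l.

Definition ternary_isomorphic (S T : Type)
    (t : ternary_op S) (t' : ternary_op T) : Prop :=
  exists2 delta : S -> T, bijective delta &
    forall a b c : S, delta (t a b c) = t' (delta a) (delta b) (delta c).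

(* A groupoid here is a set with a binary operation, with no axioms. *)
Definition groupoid_isomorphic (S T : Type) (op : S -> S -> S)
    (op' : T -> T -> T) : Prop :=
  exists2 delta : S -> T, bijective delta &
    {morph delta : a b / op a b >-> op' a b}.

Definition derived_product (S : Type) (t : ternary_op S) (l : S) : S -> S -> S :=
  fun a b : S => t l a b.

(* Main.v *)
(* With [a * b = [lab]], lateral commutativity and [a = [lla]] give
   [[abc] = (a * b) * c], so the groupoid determines the ternary operation.
   Conversely a ternary isomorphism [delta] sends [l] to a bi-unitary element
   [m] of [T], possibly different from [k]; the translation [x |-> [kmx]]
   carries the product derived at [m] to the one derived at [k]. *)
Require Import Defs.
From mathcomp Require Import all_boot.

Lemma semiheap_derived_product (S : Type) (t : ternary_op S) (l : S) :
  semiheap t -> laterally_commutative t -> bi_unitary t l ->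
  forall a b c : S,
    t a b c = derived_product t l (derived_product t l a b) c.
Proof.
(* Reversing [[lab]] to [[bal]] exposes the middle form of the semiheap law: [[l[bal]c] =
   [[lla]bc]]. *)
move=> ht ct hl a b c; rewrite /derived_product (ct l a b).
by rewrite -(ht l l a b c).1 (hl a).1.
Qed.

Lemma semiheap_assoc (S : Type) (t : ternary_op S) : semiheap t ->
  forall x y z u v : S, t (t x y z) u v = t x y (t z u v).
Proof. by move=> ht x y z u v; rewrite (ht x y z u v).1 (ht x y z u v).2. Qed.

(** Regrouping gives [[mk[kmx]] = [[mkk]mx] = [mmx] = x]. *)
Lemma translationK (S : Type) (t : ternary_op S) (k m : S) :
  semiheap t -> bi_unitary t k -> bi_unitary t m -> cancel (t k m) (t m k).
Proof.
by move=> ht hk hm x; rewrite -semiheap_assoc // -(hk m).2 (hm x).1.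
Qed.

Lemma translation_morph (S : Type) (t : ternary_op S) (k m : S) :
  semiheap t -> bi_unitary t k -> bi_unitary t m ->
  {morph t k m : a b / derived_product t m a b >-> derived_product t k a b}.
Proof.
move=> ht hk hm a b; rewrite /derived_product -semiheap_assoc // -(hm k).2.
(* The left side is now [[kab]]. With [w = [kmb]], the right side is [[k[kma]w] = [[kam]kw] =
   [ka[mkw]]], and [[mkw] = b]. *)
by rewrite -(ht k a m k _).1 semiheap_assoc // translationK.
Qed.

Lemma bi_unitary_image (S T : Type) (tS : ternary_op S) (tT : ternary_op T)
    (delta : S -> T) (l : S) :
  bijective delta ->
  (forall a b c : S, delta (tS a b c) = tT (delta a) (delta b) (delta c)) ->
  bi_unitary tS l -> bi_unitary tT (delta l).
Proof.
(* Surjectivity of [delta] carries the identities to all of [T]. *)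
move=> [g _ gK] hdelta hl x; rewrite -(gK x) -!hdelta.
by rewrite (hl (g x)).1 -(hl (g x)).2.
Qed.

Theorem corollary23 (S T : Type)
    (tS : ternary_op S) (tT : ternary_op T) (l : S) (k : T)
    (hS : semiheap tS) (hT : semiheap tT)
    (cS : laterally_commutative tS) (cT : laterally_commutative tT)
    (hl : bi_unitary tS l) (hk : bi_unitary tT k) :
  ternary_isomorphic tS tT <->
  groupoid_isomorphic (derived_product tS l) (derived_product tT k).
Proof.
split=> [[delta bij_delta hdelta] | [delta bij_delta hdelta]].
  have hm := bi_unitary_image _ _ _ _ _ _ bij_delta hdelta hl.
  exists (tT k (delta l) \o delta).
    apply: bij_comp => //.
    (* The second cancellation exchanges [k] and [delta l]. *)
    by exists (tT (delta l) k); apply: translationK.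
  by move=> a b /=; rewrite -translation_morph // /derived_product hdelta.
exists delta => // a b c.
rewrite (semiheap_derived_product _ _ _ hS cS hl) !hdelta.
by rewrite -(semiheap_derived_product _ _ _ hT cT hk).
Qed.
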